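(* Let $S=\{\phi_1,\ldots,\phi_n\}$ and $T$ be finite sets of propositional formulas, let $P=\mathit{var}(S\cup T)$, and let $G=\{g_1,\ldots,g_n\}$ be new propositional variables not in $P$, where $g_i$ is associated with $\phi_i$. For $S'\subseteq S$ let $M_{S'}=\{g_i\mid \phi_i\in S'\}$. For finite sets $T_0$ and $S_0\subseteq S$ put $\mathcal{C}[T_0,S_0]=\exists P\big(T_0\wedge\bigwedge_{\phi_k\in S_0}(g_k\to\phi_k)\big)$ (with $P$ the atoms of $S\cup T$). Then $S'$ is a maximal subset of $S$ such that $T\cup S'$ is consistent if and only if $M_{S'}$ is a model of the QBF \[ \mathcal{C}[T,S]\wedge\bigwedge_{i=1}^n\Big(\neg g_i\to\neg\,\mathcal{C}[T\cup\{\phi_i\},\,S\setminus\{\phi_i\}]\Big). \]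
   Context: A finite set of formulas is identified with the conjunction of its elements; $\mathit{var}(X)$ is the set of atoms occurring in $X$. QBFs extend propositional formulas with quantifiers over atoms; $\exists P\,\Phi$ for a finite set $P$ abbreviates successive existential quantification over its elements. An interpretation $M$ is a set of atoms; truth of a QBF under $M$ is defined as usual, with $\forall p\,\Psi$ evaluated as $\Psi[p/\top]\wedge\Psi[p/\bot]$ and $\exists p\,\Psi$ as $\Psi[p/\top]\vee\Psi[p/\bot]$. $M$ is a model of $\Phi$ iff $\Phi$ is true under $M$. *)

(* Defs.v *)
From HB Require Import structures.
From mathcomp Require Import all_boot finmap.

Set Implicit Arguments.
Unset Strict Implicit.
Unset Printing Implicit Defensive.

Local Open Scope fset_scope.

Inductive qbf (A : Type) : Type :=
  | QAtom of A
  | QTop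
  | QBot
  | QNot of qbf A
  | QAnd of qbf A & qbf A
  | QOr of qbf A & qbf A
  | QImp of qbf A & qbf A
  | QIff of qbf A & qbf A
  | QAll of A & qbf A
  | QEx of A & qbf A.

Arguments QTop {A}.
Arguments QBot {A}.

(* {fset qbf A} needs a choiceType structure on qbf A, obtained through an
   encoding into generic trees. *)
Section QbfChoice.
Variable A : Type.
Import GenTree.

Fixpoint qbf_encode (f : qbf A) : tree A :=
  match f with
  | QAtom p => Leaf p
  | QTop => Node 0 [::]
  | QBot => Node 1 [::]
  | QNot a => Node 2 [:: qbf_encode a]
  | QAnd a b => Node 3 [:: qbf_encode a; qbf_encode b]
  | QOr a b => Node 4 [:: qbf_encode a; qbf_encode b]
  | QImp a b => Node 5 [:: qbf_encode a; qbf_encode b]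
  | QIff a b => Node 6 [:: qbf_encode a; qbf_encode b]
  | QAll p a => Node 7 [:: Leaf p; qbf_encode a]
  | QEx p a => Node 8 [:: Leaf p; qbf_encode a]
  end.

Fixpoint qbf_decode (t : tree A) : option (qbf A) :=
  match t with
  | Leaf p => Some (QAtom p)
  | Node 0 [::] => Some QTop
  | Node 1 [::] => Some QBot
  | Node 2 [:: a] => omap (@QNot A) (qbf_decode a)
  | Node 3 [:: a; b] =>
      obind (fun x => omap (QAnd x) (qbf_decode b)) (qbf_decode a)
  | Node 4 [:: a; b] =>
      obind (fun x => omap (QOr x) (qbf_decode b)) (qbf_decode a)
  | Node 5 [:: a; b] =>
      obind (fun x => omap (QImp x) (qbf_decode b)) (qbf_decode a)
  | Node 6 [:: a; b] =>
      obind (fun x => omap (QIff x) (qbf_decode b)) (qbf_decode a)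
  | Node 7 [:: Leaf p; a] => omap (QAll p) (qbf_decode a)
  | Node 8 [:: Leaf p; a] => omap (QEx p) (qbf_decode a)
  | _ => None
  end.

Lemma qbf_encodeK : pcancel qbf_encode qbf_decode.
Proof.
by elim=> //= [a ->|a -> b ->|a -> b ->|a -> b ->|a -> b ->|p a ->|p a ->].
Qed.
End QbfChoice.

HB.instance Definition _ (A : choiceType) :=
  Choice.copy (qbf A) (pcan_type (@qbf_encodeK A)).

Section Defs.
Variable A : choiceType.
Implicit Types (p : A) (f : qbf A) (X S T : {fset qbf A}) (M : {pred A}).

(* Propositional formulas are the quantifier-free QBFs. *)
Fixpoint propositional f : bool :=
  match f with
  | QAtom _ | QTop | QBot => true
  | QNot a => propositional a
  | QAnd a b | QOr a b | QImp a b | QIff a b =>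
      propositional a && propositional b
  | QAll _ _ | QEx _ _ => false
  end.

Fixpoint vars f : {fset A} :=
  match f with
  | QAtom p => [fset p]
  | QTop | QBot => fset0
  | QNot a => vars a
  | QAnd a b | QOr a b | QImp a b | QIff a b => vars a `|` vars b
  | QAll p a | QEx p a => p |` vars a
  end.

Definition vars_set X : {fset A} := \bigcup_(f <- X) vars f.

(* subst p c f is f[p/c]: only free occurrences of p are replaced.  It is used
   with c = QTop or QBot only, so no capture can occur. *)
Fixpoint subst p (c : qbf A) f : qbf A :=
  match f with
  | QAtom q => if q == p then c else f
  | QTop | QBot => f
  | QNot a => QNot (subst p c a)
  | QAnd a b => QAnd (subst p c a) (subst p c b)
  | QOr a b => QOr (subst p c a) (subst p c b)
  | QImp a b => QImp (subst p c a) (subst p c b)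
  | QIff a b => QIff (subst p c a) (subst p c b)
  | QAll q a => if q == p then f else QAll q (subst p c a)
  | QEx q a => if q == p then f else QEx q (subst p c a)
  end.

Fixpoint qdepth f : nat :=
  match f with
  | QAtom _ | QTop | QBot => 1
  | QNot a | QAll _ a | QEx _ a => (qdepth a).+1
  | QAnd a b | QOr a b | QImp a b | QIff a b => (maxn (qdepth a) (qdepth b)).+1
  end.

(* The clauses for quantifiers recurse on f[p/QTop] and f[p/QBot], which are
   not subterms; k bounds the recursion depth, and qdepth f always suffices
   (the intended equations are truth_atom, ..., truth_ex below). *)
Fixpoint truth_rec (k : nat) M f : bool :=
  if k is k'.+1 then
    match f with
    | QAtom p => p \in M
    | QTop => true
    | QBot => false
    | QNot a => ~~ truth_rec k' M a
    | QAnd a b => truth_rec k' M a && truth_rec k' M b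
    | QOr a b => truth_rec k' M a || truth_rec k' M b
    | QImp a b => truth_rec k' M a ==> truth_rec k' M b
    | QIff a b => truth_rec k' M a == truth_rec k' M b
    | QAll p a =>
        truth_rec k' M (subst p QTop a) && truth_rec k' M (subst p QBot a)
    | QEx p a =>
        truth_rec k' M (subst p QTop a) || truth_rec k' M (subst p QBot a)
    end
  else false.

Definition truth M f : bool := truth_rec (qdepth f) M f.

Lemma qdepth_subst p c f : qdepth c = 1 -> qdepth (subst p c f) = qdepth f.
Proof.
move=> c1; elim: f => //=.
- by move=> q; case: ifP.
- by move=> a ->.
- by move=> a -> b ->.
- by move=> a -> b ->.
- by move=> a -> b ->.
- by move=> a -> b ->.
- by move=> q a ih; case: ifP => //= _; rewrite ih.
- by move=> q a ih; case: ifP => //= _; rewrite ih.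
Qed.

Lemma truth_recE k M f : qdepth f <= k -> truth_rec k M f = truth M f.
Proof.
rewrite /truth; have [m] := ubnP (qdepth f).
elim: m f k => // m ih f k lefm lek.
have mono a j : qdepth a < m -> qdepth a <= j ->
    truth_rec j M a = truth_rec (qdepth a) M a by exact: ih.
have sub p c a j : qdepth c = 1 -> qdepth a < m -> qdepth a <= j ->
    truth_rec j M (subst p c a)
    = truth_rec (qdepth a) M (subst p c a).
  by move=> c1 am aj; rewrite mono ?qdepth_subst.
case: f lefm lek => [p|||a|a b|a b|a b|a b|p a|p a] /=;
  case: k => //= k; rewrite !ltnS.
- by move=> am ak; rewrite mono.
- rewrite !geq_max => abm /andP[ak bk].
  have [am bm] : qdepth a < m /\ qdepth b < m.
    by move: abm; rewrite gtn_max => /andP.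
  by rewrite !(mono a) ?(mono b) ?leq_maxl ?leq_maxr.
- rewrite !geq_max => abm /andP[ak bk].
  have [am bm] : qdepth a < m /\ qdepth b < m.
    by move: abm; rewrite gtn_max => /andP.
  by rewrite !(mono a) ?(mono b) ?leq_maxl ?leq_maxr.
- rewrite !geq_max => abm /andP[ak bk].
  have [am bm] : qdepth a < m /\ qdepth b < m.
    by move: abm; rewrite gtn_max => /andP.
  by rewrite !(mono a) ?(mono b) ?leq_maxl ?leq_maxr.
- rewrite !geq_max => abm /andP[ak bk].
  have [am bm] : qdepth a < m /\ qdepth b < m.
    by move: abm; rewrite gtn_max => /andP.
  by rewrite !(mono a) ?(mono b) ?leq_maxl ?leq_maxr.
- by move=> am ak; rewrite !sub.
- by move=> am ak; rewrite !sub.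
Qed.

Lemma truth_atom M p : truth M (QAtom p) = (p \in M).
Proof. by []. Qed.
Lemma truth_top M : truth M QTop = true.
Proof. by []. Qed.
Lemma truth_bot M : truth M QBot = false.
Proof. by []. Qed.
Lemma truth_not M a : truth M (QNot a) = ~~ truth M a.
Proof. by []. Qed.
Lemma truth_and M a b : truth M (QAnd a b) = truth M a && truth M b.
Proof. by rewrite {1}/truth /= !truth_recE ?leq_maxl ?leq_maxr. Qed.
Lemma truth_or M a b : truth M (QOr a b) = truth M a || truth M b.
Proof. by rewrite {1}/truth /= !truth_recE ?leq_maxl ?leq_maxr. Qed.
Lemma truth_imp M a b : truth M (QImp a b) = (truth M a ==> truth M b).
Proof. by rewrite {1}/truth /= !truth_recE ?leq_maxl ?leq_maxr. Qed.
Lemma truth_iff M a b : truth M (QIff a b) = (truth M a == truth M b).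
Proof. by rewrite {1}/truth /= !truth_recE ?leq_maxl ?leq_maxr. Qed.
Lemma truth_all M p a :
  truth M (QAll p a) = truth M (subst p QTop a) && truth M (subst p QBot a).
Proof. by rewrite {1}/truth /= !truth_recE ?qdepth_subst. Qed.
Lemma truth_ex M p a :
  truth M (QEx p a) = truth M (subst p QTop a) || truth M (subst p QBot a).
Proof. by rewrite {1}/truth /= !truth_recE ?qdepth_subst. Qed.

Definition is_model M f : Prop := truth M f.

Definition conj_set X : qbf A := \big[@QAnd A/QTop]_(f <- X) f.

Definition ex_set (P : {fset A}) f : qbf A := foldr (@QEx A) f P.

Definition consistent X : Prop := exists M, is_model M (conj_set X).

Definition maximal_consistent S T S' : Prop :=
  [/\ S' `<=` S, consistent (T `|` S') &
      forall S'', S'' `<=` S -> S' `<` S'' -> ~ consistent (T `|` S'')].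

Section Guarded.
Variables (n : nat) (phi : 'I_n -> qbf A) (g : 'I_n -> A).

Definition guards S' : {fset A} := [fset g i | i in 'I_n & phi i \in S'].

(* The formula C[T0, S0]. *)
Definition C_qbf (P : {fset A}) (T0 S0 : {fset qbf A}) : qbf A :=
  ex_set P
    (QAnd (conj_set T0)
       (\big[@QAnd A/QTop]_(k < n | phi k \in S0) QImp (QAtom (g k)) (phi k))).

Definition max_qbf (P : {fset A}) S T : qbf A :=
  QAnd (C_qbf P T S)
    (\big[@QAnd A/QTop]_(i < n)
       QImp (QNot (QAtom (g i)))
            (QNot (C_qbf P (phi i |` T) (S `\ phi i)))).

End Guarded.
End Defs.

(* Main.v *)
(** Truth of a QBF, defined by syntactic substitution, coincides with the
    compositional semantics in which a quantifier ranges over the two updates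
    of the interpretation.  Hence [C[T0,S0]] holds under [M_{S'}] iff some
    interpretation that agrees with [M_{S'}] outside [P], in particular on the
    guards, satisfies [T0] and [S0 `&` S'], i.e. iff [T0 `|` (S0 `&` S')] is
    consistent.  As consistency is inherited by subsets, [S'] is maximal iff
    no single [phi i] outside [S'] can be added to it. *)
Require Import Defs.
From HB Require Import structures.
From mathcomp Require Import all_boot finmap.

Local Open Scope fset_scope.

Section Semantics.
Variable A : choiceType.
Implicit Types (p : A) (M N : {pred A}) (f : qbf A).

Definition upd M p (b : bool) : {pred A} :=
  fun x => if x == p then b else x \in M.

(** Quantifiers update the interpretation instead of the formula, so the recursion is structural and
    proofs can go by induction on [f]. *)
Fixpoint sem M f : bool :=
  match f with
  | QAtom p => p \in M
  | QTop => true
  | QBot => false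
  | QNot a => ~~ sem M a
  | QAnd a b => sem M a && sem M b
  | QOr a b => sem M a || sem M b
  | QImp a b => sem M a ==> sem M b
  | QIff a b => sem M a == sem M b
  | QAll p a => sem (upd M p true) a && sem (upd M p false) a
  | QEx p a => sem (upd M p true) a || sem (upd M p false) a
  end.

Lemma in_upd M p b x : (x \in upd M p b) = if x == p then b else x \in M.
Proof. by []. Qed.

(** Under a quantifier both interpretations receive the same update, so they still agree on the
    atoms of the body. *)
Lemma eq_sem_vars f M N :
  (forall x, x \in vars f -> (x \in M) = (x \in N)) -> sem M f = sem N f.
Proof.
elim: f M N => [p|||a iha|a iha b ihb|a iha b ihb|a iha b ihb|a iha b ihb
  |p a iha|p a iha] M N //= MN; first by apply: MN; rewrite inE.
- by rewrite (iha M N).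
1-4: by rewrite (iha M N) ?(ihb M N) // => x xv;
     apply: MN; rewrite inE xv ?orbT.
all: have MNp c x : x \in vars a -> (x \in upd M p c) = (x \in upd N p c)
       by move=> xv; rewrite !in_upd; case: eqP => // _;
          apply: MN; rewrite !inE xv orbT.
all: by rewrite !(iha _ _ (MNp _)).
Qed.

Lemma eq_sem f M N : M =i N -> sem M f = sem N f.
Proof. by move=> MN; apply: eq_sem_vars => x _; apply: MN. Qed.

(** Updates at distinct atoms commute, which handles a quantifier over another atom. A quantifier
    over [p] itself blocks the substitution, and its own update overrides the one by [b]. *)
Lemma sem_subst p (b : bool) f M :
  sem M (subst p (if b then QTop else QBot) f) = sem (upd M p b) f.
Proof.
have updC N q c : q != p -> upd (upd N q c) p b =i upd (upd N p b) q c.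
  move=> qp x; rewrite !in_upd.
  by case: (eqVneq x p) => // ->; rewrite eq_sym (negPf qp).
have updK N c : upd (upd N p b) p c =i upd N p c.
  by move=> x; rewrite !in_upd; case: eqP.
elim: f M => [q|||a iha|a iha c ihc|a iha c ihc|a iha c ihc|a iha c ihc
  |q a iha|q a iha] M //=; rewrite ?iha ?ihc //.
- by rewrite in_upd; case: ifP => // _; case: b {updC updK}.
- case: eqVneq => [->|qp] /=; first by rewrite !(eq_sem _ _ _ (updK _ _)).
  by rewrite !iha !(eq_sem _ _ _ (updC _ _ _ qp)).
- case: eqVneq => [->|qp] /=; first by rewrite !(eq_sem _ _ _ (updK _ _)).
  by rewrite !iha !(eq_sem _ _ _ (updC _ _ _ qp)).
Qed.

(** The induction is on depth: an instantiated quantifier body is not a subformula, but it has the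
    depth of the original body. *)
Lemma truthE M f : truth M f = sem M f.
Proof.
have [m] := ubnP (qdepth f); elim: m f => // m ih f.
case: f => [p|||a|a b|a b|a b|a b|p a|p a] //=; rewrite ltnS.
- by move=> am; rewrite truth_not ih.
1-4: by rewrite gtn_max => /andP[am bm];
     rewrite ?(truth_and, truth_or, truth_imp, truth_iff) !ih.
all: by move=> am; rewrite ?(truth_all, truth_ex) !ih ?qdepth_subst //
     (sem_subst p true) (sem_subst p false).
Qed.

Lemma truth_bigand M (I : Type) (r : seq I) (Q : pred I) (F : I -> qbf A) :
  truth M (\big[@QAnd A/QTop]_(i <- r | Q i) F i)
  = \big[andb/true]_(i <- r | Q i) truth M (F i).
Proof. exact: (big_morph (truth M) (truth_and M) (truth_top M)). Qed.

Lemma truth_conj_setP M (X : {fset qbf A}) :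
  reflect {in X, forall f, truth M f} (truth M (conj_set X)).
Proof. by rewrite truth_bigand big_all; apply: allP. Qed.

Lemma truth_ex_setP M (P : {fset A}) f :
  reflect (exists2 N, (forall x, x \notin P -> (x \in N) = (x \in M))
                      & truth N f)
          (truth M (ex_set P f)).
Proof.
rewrite truthE /ex_set.
(* Generalised to arbitrary lists and base interpretations, since each quantifier shortens the list
   and updates the base. *)
suff H (s : seq A) N0 :
    reflect (exists2 N : {pred A}, (forall x, x \notin s -> (x \in N) = (x \in N0))
                         & sem N f)
            (sem N0 (foldr (@QEx A) f s)).
  apply: (iffP (H P M)) => -[N NM]; first by rewrite -truthE; exists N.
  by rewrite truthE; exists N.
elim: s N0 => [|p s ih] N0 /=.
  apply: (iffP idP) => [|[N NM]]; first by exists N0.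
  by rewrite (eq_sem _ N N0) // => x; apply: NM.
apply: (iffP orP) => [|[N NM Nf]].
  by case=> /ih[N NM Nf]; exists N => // x; rewrite inE negb_or => /andP[xp xs];
     rewrite NM // in_upd (negPf xp).
(* The value of [p] in the witness [N] selects the disjunct. *)
suff: sem (upd N0 p (p \in N)) (foldr (@QEx A) f s).
  by case: (p \in N); [left | right].
apply/ih; exists N => // x xs; rewrite in_upd.
by case: eqVneq => [-> //|xp]; rewrite NM // inE negb_or xp.
Qed.

Lemma consistent_sub (X Y : {fset qbf A}) :
  X `<=` Y -> consistent Y -> consistent X.
Proof.
move=> /fsubsetP XY [M /truth_conj_setP MY].
by exists M; apply/truth_conj_setP => f /XY; apply: MY.
Qed.

Lemma vars_sub_set (X : {fset qbf A}) f : f \in X -> vars f `<=` vars_set X.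
Proof.
by move=> fX; apply/fsubsetP => x xf; apply/bigfcupP; exists f; rewrite ?fX.
Qed.

End Semantics.

Section Guarded.
Variables (A : choiceType) (n : nat) (phi : 'I_n -> qbf A) (g : 'I_n -> A).
Variables (P : {fset A}) (S' : {fset qbf A}).
Hypotheses (g_inj : injective g) (g_new : forall i, g i \notin P).

(** Injectivity of [g] ensures that [g i] can only come from the index [i]. *)
Lemma mem_guards i : (g i \in guards phi g S') = (phi i \in S').
Proof.
apply/imfsetP/idP => [[j /= jS /g_inj -> //]|iS].
by exists i; rewrite // inE.
Qed.

Lemma truth_C_qbfP (T0 S0 : {fset qbf A}) :
    S0 `<=` [fset phi i | i in 'I_n] ->
    (forall f, f \in T0 `|` S0 -> vars f `<=` P) ->
  truth [in guards phi g S'] (C_qbf phi g P T0 S0)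
  <-> consistent (T0 `|` (S0 `&` S')).
Proof.
move=> /fsubsetP S0_sub vP; split.
  case/truth_ex_setP => N NM; rewrite truth_and [X in _ && X]truth_bigand big_andE.
  case/andP => /truth_conj_setP NT /'forall_implyP NS.
  exists N; apply/truth_conj_setP => f; rewrite !inE.
  case/orP => [/NT //|/andP[fS0 fS']].
  have /imfsetP[k _ fk] := S0_sub _ fS0; rewrite fk /= in fS0 fS' *.
  (* The guard [g k] lies outside [P], so [N] gives it the value prescribed by [S']. *)
  have := NS k fS0; rewrite truth_imp truth_atom NM //.
  by rewrite [g k \in _]mem_guards fS'.
case=> N0 /truth_conj_setP N0X; apply/truth_ex_setP.
(* Glue the given model on [P] to the guards elsewhere; formulas over [P] cannot tell [N] from
   [N0]. *)
pose N : {pred A} := fun x => if x \in P then x \in N0 else x \in guards phi g S'.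
have inN x : (x \in N) = if x \in P then x \in N0 else x \in guards phi g S'.
  by [].
have NN0 f : f \in T0 `|` S0 -> truth N f = truth N0 f.
  move=> fX; rewrite !truthE; apply: eq_sem_vars => x.
  by move/(fsubsetP (vP _ fX)) => xP; rewrite inN xP.
exists N => [x /negPf xP|]; first by rewrite inN xP.
rewrite truth_and [X in _ && X]truth_bigand big_andE; apply/andP; split.
  by apply/truth_conj_setP => f fT; rewrite NN0 ?N0X // inE fT.
apply/'forall_implyP => k kS0; rewrite truth_imp truth_atom.
rewrite inN (negPf (g_new k)) mem_guards; apply/implyP => kS'.
by rewrite NN0 ?N0X // !inE kS0 ?kS' orbT.
Qed.

End Guarded.

Theorem theorem1 (A : choiceType) (n : nat) (phi : 'I_n -> qbf A)
    (S T : {fset qbf A}) (P : {fset A}) (g : 'I_n -> A)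
    (S_prop : forall i, propositional (phi i))
    (T_prop : forall f, f \in T -> propositional f)
    (S_def : S = [fset phi i | i in 'I_n])
    (P_def : P = vars_set (S `|` T))
    (g_inj : injective g)
    (g_new : forall i, g i \notin P)
    (S' : {fset qbf A}) (S'_sub : S' `<=` S) :
  maximal_consistent S T S' <->
  is_model [in guards phi g S'] (max_qbf phi g P S T).
Proof.
have phiS i : phi i \in S by rewrite S_def; apply/imfsetP; exists i.
have vP f : f \in S `|` T -> vars f `<=` P by rewrite P_def; apply: vars_sub_set.
have CTS : truth [in guards phi g S'] (C_qbf phi g P T S)
           <-> consistent (T `|` S').
  have {2}-> : S' = S `&` S' by apply/esym/fsetIidPr.
  by apply: truth_C_qbfP; rewrite ?S_def // -?S_def fsetUC.
have Ci i : phi i \notin S' ->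
    truth [in guards phi g S'] (C_qbf phi g P (phi i |` T) (S `\ phi i))
    <-> consistent (T `|` (phi i |` S')).
  move=> iS'.
  (* As [phi i] is not in [S'], removing it from [S] leaves the intersection with [S'] unchanged. *)
  have -> : T `|` (phi i |` S') = (phi i |` T) `|` ((S `\ phi i) `&` S').
    have -> : (S `\ phi i) `&` S' = S'.
      by apply/fsetIidPr; rewrite fsubsetD1 S'_sub.
    by rewrite fsetUCA fsetUA.
  apply: truth_C_qbfP => // [|f]; first by rewrite -S_def fsubD1set.
  rewrite !inE -orbA => /or3P[/eqP->|fT|/andP[_ fS]]; apply: vP; rewrite inE.
  - by rewrite phiS.
  - by rewrite fT orbT.
  - by rewrite fS.
have guardE i : truth [in guards phi g S'] (QAtom (g i)) = (phi i \in S').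
  exact: (mem_guards _ _ _ _ _ g_inj).
rewrite /is_model truth_and truth_bigand big_andE; split.
  case=> _ /CTS CS max_S'; rewrite CS; apply/forallP => i.
  rewrite implyTb truth_imp !truth_not guardE; apply/implyP => iS'.
  (* Maximality is applied to the one-element extension of [S'] by [phi i]. *)
  apply/negP => /(Ci _ iS'); apply: max_S'; first by rewrite fsubUset fsub1set phiS.
  by rewrite fproperE fsubsetUr fsubUset fsub1set (negPf iS').
case/andP => /CTS con_S' /forallP no_i; split=> // S'' S''S.
rewrite fproperE => /andP[S'S'' /fsubsetPn[f fS'' fS']] con_S''.
have := fsubsetP S''S f fS''; rewrite S_def => /imfsetP[i _ /= fi].
rewrite fi in fS'' fS'.
have := no_i i; rewrite implyTb truth_imp !truth_not guardE fS' /= => /negP; apply.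
(* A consistent proper extension [S''] contains some [phi i] outside [S'], so adding just [phi i] to
   [S'] is already consistent. *)
apply/(Ci _ fS'); apply: consistent_sub con_S''.
by rewrite fsetUS // fsubUset fsub1set fS''.
Qed.
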